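(* Let $(K,S)$ be a topological dynamical system such that $K$ is locally connected and the semigroup $S$ acts on $K$ via monotone maps, i.e. for each $s\in S$ the map $K\to K$, $x\mapsto sx$, is monotone. Then the factor map from $(K,S)$ onto its maximal equicontinuous factor is monotone.
   Context: Compact spaces are Hausdorff. A topological dynamical system $(K,S)$ is a continuous action $S\times K\to K$ of a topological semigroup $S$ on a compact space $K$. A map $p\colon X\to Y$ of topological spaces is monotone if for each $y\in Y$ the preimage $p^{-1}(y)$ is a connected subset of $X$. A factor map $p\colon(K,S)\to(L,S)$ is a continuous, surjective, $S$-equivariant map $K\to L$; $(L,S)$ is then a factor of $(K,S)$. A system $(K,S)$ is equicontinuous if the family of maps $\{x\mapsto sx\mid s\in S\}\subset C(K,K)$ is (uniformly) equicontinuous. The maximal equicontinuous factor of $(K,S)$ is the equicontinuous factor through which every factor map onto an equicontinuous system factorizes. Equivalently, with $C(K)$ the continuous complex-valued functions on $K$ and $(T_sf)(x)=f(sx)$, it is the quotient of $K$ by the closed equivalence relation identifying $x$ and $y$ whenever $f(x)=f(y)$ for all $f$ in the $C^*$-subalgebra $\mathcal{A}_{\mathrm{eq}}=\{f\in C(K)\mid \{T_sf\mid s\in S\}\text{ is equicontinuous}\}$, with the induced action of $S$. *)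

(* Defs.v *)
From HB Require Import structures.
From mathcomp Require Import all_boot all_classical.
From mathcomp Require Import topology.

Set Implicit Arguments.
Unset Strict Implicit.
Unset Printing Implicit Defensive.

Local Open Scope classical_set_scope.

HB.mixin Record isTopologicalSemigroup S of Topological S & Semigroup S := {
  mulg_continuous : continuous (fun st : S * S => (st.1 * st.2)%g)
}.

(* No identity element and no separation axiom is assumed. *)
#[short(type="topSemigroupType")]
HB.structure Definition TopologicalSemigroup :=
  {S of Topological S & Semigroup S & isTopologicalSemigroup S}.

Record tds (S : topSemigroupType) := Tds {
  tds_space :> topologicalType;
  tds_compact : compact [set: tds_space];
  tds_hausdorff : hausdorff_space tds_space;
  act : S -> tds_space -> tds_space;
  act_mul : forall s t x, act (s * t)%g x = act s (act t x);
  act_continuous :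
    continuous (fun sx : S * tds_space => act sx.1 sx.2)
}.
Arguments act {S K} s x : rename.

Definition locally_connected (T : topologicalType) :=
  forall (x : T) (U : set T), nbhs x U ->
    exists V : set T, [/\ open V, V x, connected V & V `<=` U].

(* The empty set is connected, so a monotone map need not be surjective. *)
Definition monotone_map (X Y : topologicalType) (p : X -> Y) :=
  forall y, connected (p @^-1` [set y]).

Definition diagonal_nbhs (T : topologicalType) (E : set (T * T)) :=
  forall x : T, nbhs (x, x) E.

(* A compact Hausdorff space has exactly one compatible uniformity; by the lemma
   below its entourages are the neighbourhoods of the diagonal. *)
Lemma compact_entourageE (T : uniformType) (E : set (T * T)) :
  compact [set: T] -> entourage E <-> diagonal_nbhs E.
Proof.
move=> cT; split=> [entE x|dE].
  have entE2 := entourage_split_ent entE.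
  exists (xsection ((split_ent E)^-1)%relation x, xsection (split_ent E) x).
    by split; apply: nbhs_entourage => //; exact: entourage_inv.
  move=> [y z] /= [/xsectionP yx /xsectionP xz].
  exact: (entourage_split x).
have /compact_near_coveringP cvT := cT.
pose F := filter_from (@entourage T) (fun D : set (T * T) => [set D' | D' `<=` D]).
have FF : Filter F.
  apply: filter_from_filter; first by exists setT; exact: filterT.
  move=> A B entA entB; exists (A `&` B); first exact: filterI.
  by move=> D /= DAB; split => u /DAB[].
have [x _|D entD sub] := cvT _ _
    (fun (D : set (T * T)) x => forall y, D (x, y) -> E (x, y)) FF.
  have [[A B] /= [xA xB] ABE] := dE x.
  have /nbhsP [G entG GAB] : nbhs x (A `&` B) by exact: filterI.
  exists (xsection (split_ent G) x, [set D | D `<=` split_ent G]).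
    split => /=; first exact/nbhs_entourage/entourage_split_ent.
    by exists (split_ent G) => //; exact: entourage_split_ent.
  move=> [x' D] /= [/xsectionP xx' DG] y Dx'y; apply: ABE; split => /=.
    have /GAB[] // : xsection G x x'.
    apply/xsectionP/(entourage_split x' entG) => //.
    by apply: entourage_refl; exact: entourage_split_ent.
  have /GAB[] // : xsection G x y.
  by apply/xsectionP/(entourage_split x' entG) => //; exact: DG.
by apply: filterS entD => -[x y]; exact: (sub D (@subset_refl _ D) x I).
Qed.

Section Systems.
Variable S : topSemigroupType.
Implicit Types K L : tds S.

Definition equicontinuous_tds K :=
  forall E : set (K * K), diagonal_nbhs E ->
    exists2 D : set (K * K), diagonal_nbhs D &
      forall (s : S) (x y : K), D (x, y) -> E (act s x, act s y).

Definition factor_map K L (p : K -> L) :=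
  [/\ continuous p, set_surj [set: K] [set: L] p &
      forall s x, p (act s x) = act s (p x)].

(* Universal property: it determines p up to a unique isomorphism under K. *)
Definition maximal_equicontinuous_factor K L (p : K -> L) :=
  [/\ equicontinuous_tds L, factor_map p &
      forall (M : tds S) (q : K -> M), equicontinuous_tds M -> factor_map q ->
        exists2 r : L -> M, factor_map r & q = r \o p].

End Systems.

(* Main.v *)
Require Import Defs.
From HB Require Import structures.
From mathcomp Require Import all_boot all_classical.
From mathcomp Require Import topology.

(** Call [x] and [y] in [K] [F]-chained, for a neighbourhood [F] of the diagonal
    of [L], when some connected set contains both and its image under [p] is
    [F]-small.  Two connected sets with a common point have a connected union,
    so as [F] varies these relations are the base of a uniformity [U] on [K].

    - Local connectedness makes [U] coarser than the uniformity of [K]: every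
      point has small connected neighbourhoods.
    - [S] acts equicontinuously for [U]: if [F'] controls [F] on the
      equicontinuous system [L] and [C] is connected with [p C] [F']-small, then
      [s C] is connected and [p (s C) = s (p C)] is [F]-small.

    Hence the Hausdorff quotient of [(K, U)] is a compact Hausdorff
    equicontinuous system and a factor of [K] ([chain_quotient]).  By maximality
    its quotient map factors through [p], so two points of one fibre of [p] are
    [F]-chained for every [F].  This forces the fibre over [y0] to be connected
    ([chained_fiber_connected]): if it split into two closed pieces, a closed
    set [Z] missing the fibre would separate them, [p Z] would be compact and
    miss [y0], and a connected set joining the pieces with its image close
    enough to [y0] would avoid [Z]. *)

Set Implicit Arguments.
Unset Strict Implicit.
Unset Printing Implicit Defensive.

Local Open Scope classical_set_scope.
Local Open Scope quotient_scope.

(** * Neighbourhoods of the diagonal *)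

Section DiagonalNbhds.
Variable T : topologicalType.
Implicit Types D E F : set (T * T).

Lemma diagonal_nbhs_refl F x : diagonal_nbhs F -> F (x, x).
Proof. by move=> /(_ x)/nbhs_singleton. Qed.

Lemma diagonal_nbhsT : diagonal_nbhs [set: T * T].
Proof. by move=> x; exact: filterT. Qed.

Lemma diagonal_nbhsI D E :
  diagonal_nbhs D -> diagonal_nbhs E -> diagonal_nbhs (D `&` E).
Proof. by move=> dD dE x; apply: filterI; [exact: dD|exact: dE]. Qed.

(** Halving of entourages, for a space given by its topology alone.  By
    compactness it is enough to find, for each middle point [y], one [D] that
    works near [y].  If [F] contains the square of an open [A] around [y] and
    [B] is a neighbourhood of [y] with closure inside [A], take for [D] the pairs
    that do not lead from [B] out of [A], in either direction. *)
Lemma diagonal_nbhs_split F :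
  compact [set: T] -> hausdorff_space T -> diagonal_nbhs F ->
  exists2 D, diagonal_nbhs D &
    forall x y z, D (x, y) -> D (y, z) -> F (x, z).
Proof.
move=> cT hT dF; have /compact_near_coveringP cvT := cT.
pose small := filter_from (@diagonal_nbhs T)
  (fun D : set (T * T) => [set D' | D' `<=` D]).
have smallF : Filter small.
  apply: filter_from_filter; first by exists setT; exact: diagonal_nbhsT.
  move=> A B dA dB; exists (A `&` B); first exact: diagonal_nbhsI.
  by move=> D /= DAB; split => u /DAB[].
have [y _|D dD sub] := cvT _ _ (fun (D : set (T * T)) y =>
    forall x z, D (x, y) -> D (y, z) -> F (x, z)) smallF; last first.
  by exists D => // x y z; exact: (sub D (@subset_refl _ D) y I).
have [[A1 A2] /= [yA1 yA2] AF] := dF y.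
have yA : nbhs y (A1 `&` A2)° by apply: nbhs_interior; exact: filterI.
have [B yB clBA] := compact_regular hT cT (@filterT _ (nbhs y) _) yA.
set A := (A1 `&` A2)° in yA clBA.
pose D := [set uv : T * T | (B uv.1 -> A uv.2) /\ (B uv.2 -> A uv.1)].
have dD : diagonal_nbhs D.
  move=> w; have [wB|wB] := pselect (closure B w).
    have wA : nbhs w A.
      by apply: open_nbhs_nbhs; split; [exact: open_interior|exact: clBA].
    by exists (A, A) => // -[u v] [/= uA vA]; split.
  have wA : nbhs w (~` closure B).
    apply: open_nbhs_nbhs; split => //.
    by apply: closed_openC; exact: closed_closure.
  by exists (~` closure B, ~` closure B) => // -[u v] [/= uB vB];
    split => /= /subset_closure.
exists (B, [set D' | D' `<=` D]); first by split => //; exists D.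
move=> [y' D'] [/= y'B D'D] x z /D'D[_ /= /(_ y'B) xA] /D'D[/= /(_ y'B) zA _].
by apply: AF; split; [have /interior_subset[] := xA|have /interior_subset[] := zA].
Qed.

End DiagonalNbhds.

(** * The Hausdorff quotient of a uniformity *)

(** Unbundled from the carrier: the chain uniformity lives on a space that
    already carries its own, finer, topology. *)
Record uniformity (T : Type) := Uniformity {
  unif : set_system (T * T);
  unif_filter : Filter unif;
  unif_refl : forall E x, unif E -> E (x, x);
  unif_inv : forall E, unif E -> unif [set xy | E (xy.2, xy.1)];
  unif_split : forall E, unif E -> exists2 D, unif D &
    forall x y z, D (x, y) -> D (y, z) -> E (x, z)
}.
#[global] Existing Instance unif_filter.

Section HausdorffQuotient.
Variables (T : choiceType) (U : uniformity T).

Definition inseparable (x y : T) := `[< forall E, unif U E -> E (x, y) >].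

Lemma inseparable_refl : reflexive inseparable.
Proof. by move=> x; apply/asboolP => E; exact: unif_refl. Qed.

Lemma inseparable_sym : symmetric inseparable.
Proof.
by move=> x y; apply/asboolP/asboolP => xy E UE; exact: (xy _ (unif_inv UE)).
Qed.

Lemma inseparable_trans : transitive inseparable.
Proof.
move=> y x z /asboolP xy /asboolP yz; apply/asboolP => E UE.
have [D UD] := unif_split UE; apply; [exact: xy|exact: yz].
Qed.

Canonical inseparable_equiv :=
  EquivRel inseparable inseparable_refl inseparable_sym inseparable_trans.

Definition hquot := {eq_quot inseparable_equiv}.
HB.instance Definition _ := Choice.on hquot.
HB.instance Definition _ := EqQuotient.on hquot.

Definition to_hquot (x : T) : hquot := \pi_hquot x.

Lemma to_hquotP x y :
  to_hquot x = to_hquot y <-> (forall E, unif U E -> E (x, y)).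
Proof.
split=> [xy|xy]; first exact/asboolP/(@eqmodP _ inseparable_equiv).
by apply/(@eqmodP _ inseparable_equiv)/asboolP.
Qed.

Lemma to_hquot_repr (m : hquot) : to_hquot (repr m) = m.
Proof. exact: reprK. Qed.

Definition hquot_ent : set_system (hquot * hquot) :=
  [set E | unif U [set xy | E (to_hquot xy.1, to_hquot xy.2)]].

Definition hquot_image (E : set (T * T)) : set (hquot * hquot) :=
  [set mn | exists2 xy, E xy & mn = (to_hquot xy.1, to_hquot xy.2)].

Lemma hquot_ent_image E : unif U E -> hquot_ent (hquot_image E).
Proof. by apply: filterS => xy ?; exists xy. Qed.

(** [to_hquot] loses no uniform information: the preimage of the image of a
    small entourage only enlarges it by inseparable pairs on either side. *)
Lemma hquot_image_sub E : unif U E -> exists2 D, unif U D &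
  forall x y, hquot_image D (to_hquot x, to_hquot y) -> E (x, y).
Proof.
move=> /unif_split[G UG GE]; have [D UD DG] := unif_split UG.
exists D => // x y [[x' y'] /= x'y' [/to_hquotP xx' /esym/to_hquotP y'y]].
exact: GE (DG _ _ _ (xx' _ UD) x'y') (y'y _ UG).
Qed.

Lemma hquot_ent_filter : Filter hquot_ent.
Proof.
split; first exact: filterT.
- by move=> A B; exact: filterI.
- by move=> A B AB; apply: filterS => xy; exact: AB.
Qed.

Lemma hquot_ent_refl A : hquot_ent A -> diagonal `<=` A.
Proof.
move=> UA [m n] /diagonalP; rewrite -(to_hquot_repr m) => <-.
exact: (unif_refl (repr m) UA).
Qed.

Lemma hquot_ent_inv A : hquot_ent A -> hquot_ent A^-1%relation.
Proof. exact: unif_inv. Qed.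

Lemma hquot_ent_split A : hquot_ent A ->
  exists2 B, hquot_ent B & (B \; B)%relation `<=` A.
Proof.
move=> /unif_split[G UG GA]; have [D UD DG] := hquot_image_sub UG.
exists (hquot_image D); first exact: hquot_ent_image.
move=> [m n] [k /=].
rewrite -(to_hquot_repr m) -(to_hquot_repr n) -(to_hquot_repr k) => /DG mk /DG.
exact: GA mk.
Qed.

HB.instance Definition _ := isUniform.Build hquot
  hquot_ent_filter hquot_ent_refl hquot_ent_inv hquot_ent_split.

Lemma hquot_hausdorff : hausdorff_space hquot.
Proof.
move=> m n mn; rewrite -(to_hquot_repr m) -(to_hquot_repr n).
have {}mn : close m n by rewrite closeEnbhs.
apply/to_hquotP => E /hquot_image_sub[D UD]; apply.
rewrite !to_hquot_repr; move: mn; rewrite entourage_close; apply.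
exact: hquot_ent_image.
Qed.

End HausdorffQuotient.

(** * Points joined by connected sets with small image *)

Section Chaining.
Variables (K L : topologicalType) (p : K -> L).

Definition chained (F : set (L * L)) : set (K * K) :=
  [set xy | exists C : set K, [/\ connected C, C xy.1, C xy.2 &
    forall u v, C u -> C v -> F (p u, p v)]].

Lemma chained_refl F x : diagonal_nbhs F -> chained F (x, x).
Proof.
move=> dF; exists [set x]; split => //; first exact: connected1.
by move=> u v -> ->; exact: diagonal_nbhs_refl.
Qed.

Lemma chained_sym F x y : chained F (x, y) -> chained F (y, x).
Proof. by move=> [C [? ? ? ?]]; exists C. Qed.

Lemma chained_sub F G : F `<=` G -> chained F `<=` chained G.
Proof.
by move=> FG xy [C [? ? ? CF]]; exists C; split=> // u v Cu /(CF _ _ Cu)/FG.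
Qed.

(** The connected sets for the two pairs share [y], so their union is connected,
    and each of its image points is [G]-close to [p y]. *)
Lemma chained_trans F G x y z : diagonal_nbhs G ->
  (forall a b c, G (a, b) -> G (b, c) -> F (a, c)) ->
  chained G (x, y) -> chained G (y, z) -> chained F (x, z).
Proof.
move=> dG GF [C [cC /= Cx Cy CG]] [D [cD /= Dy Dz DG]].
exists (C `|` D); split; [by apply: connectedU => //; exists y|by left|by right|].
have Gy u : (C `|` D) u -> G (p u, p y) /\ G (p y, p u).
  by move=> [Cu|Du]; split; [exact: CG|exact: CG|exact: DG|exact: DG].
by move=> u v /Gy[uy _] /Gy[_ yv]; exact: GF uy yv.
Qed.

Lemma chained_diagonal_nbhs F : locally_connected K -> continuous p ->
  diagonal_nbhs F -> diagonal_nbhs (chained F).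
Proof.
move=> lcK cp dF x; have [[A B] /= [xA xB] ABF] := dF (p x).
have [V [oV Vx cV VAB]] : exists V : set K,
    [/\ open V, V x, connected V & V `<=` p @^-1` (A `&` B)].
  by apply: lcK; apply: cp; exact: filterI.
exists (V, V); first by split; exact: open_nbhs_nbhs.
move=> [u v] [/= Vu Vv]; exists V; split => // u' v' /VAB[Au' _] /VAB[_ Bv'].
exact: ABF.
Qed.

(** Let [B] be a nonempty clopen part of the fibre, cut out by an open [O].  By
    normality [B] has a neighbourhood [V] with closure inside [O], and the
    frontier [Z] of [V] misses the fibre.  A connected set that meets [B] and
    avoids [Z] stays inside [V], hence reaches no point of the fibre outside
    [B]. *)
Lemma chained_fiber_connected y0 : compact [set: K] -> hausdorff_space K ->
  hausdorff_space L -> continuous p ->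
  (forall x y, p x = y0 -> p y = y0 ->
     forall F, diagonal_nbhs F -> chained F (x, y)) ->
  connected (p @^-1` [set y0]).
Proof.
move=> cK hK hL cp chain B [x Bx] [O oO BO] [D cD BD].
have cly0 : closed [set y0].
  exact/accessible_closed_set1/hausdorff_accessible.
have clB : closed B.
  by rewrite BD; apply: closedI => //; apply: preimage_closed => // ? _; exact: cp.
have [V BV clVO] : filter_from (set_nbhs B) closure O.
  apply: (compact_normal hK cK clB) => z Bz; apply: open_nbhs_nbhs.
  by split => //; move: Bz; rewrite BO => -[].
pose Z := closure V `\` V°.
have clZ : closed Z.
  apply: closedI; first exact: closed_closure.
  exact/open_closedC/open_interior.
have cpZ : closed (p @` Z).
  apply: compact_closed => //; apply: continuous_compact.
    exact: continuous_subspaceT.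
  exact: subclosed_compact clZ cK _.
have y0Z : ~ (p @` Z) y0.
  move=> [z [Vz nVz] pz]; apply: nVz; apply: BV.
  by rewrite BO; split => //; exact: clVO.
(* An [F]-small set that contains [y0] is disjoint from [p @` Z]. *)
pose F : set (L * L) := [set uv | uv.1 <> y0 \/ ~ (p @` Z) uv.2].
have dF : diagonal_nbhs F.
  move=> w; have [->|wy0] := pselect (w = y0).
    exists (setT, ~` (p @` Z)); last by move=> [u v] [_ /= ?]; right.
    split; [exact: filterT|apply: open_nbhs_nbhs; split => //].
    exact: closed_openC.
  exists (~` [set y0], setT); last by move=> [u v] [/= ? _]; left.
  split; [apply: open_nbhs_nbhs; split => //|exact: filterT].
  exact: closed_openC.
have px : p x = y0 by move: Bx; rewrite BO => -[].
apply/seteqP; split=> [z|y py]; first by rewrite BO => -[].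
have [C [cC /= Cx Cy CF]] := chain x y px py F dF.
have CZ z : C z -> ~ Z z.
  by move=> Cz Zz; have [//|] := CF _ _ Cx Cz; apply; exists z.
have CV : C `&` V° = C.
  apply: cC; first by exists x; split => //; exact: BV.
    by exists V° => //; exact: open_interior.
  exists (closure V); first exact: closed_closure.
  apply/seteqP; split=> z [Cz Vz]; split => //.
    exact: subset_closure (interior_subset Vz).
  by apply: contrapT => nVz; exact: CZ Cz (conj Vz nVz).
have Vy : V° y by move: Cy; rewrite -CV => -[].
by rewrite BO; split => //; exact: clVO (subset_closure (interior_subset Vy)).
Qed.

Hypotheses (cL : compact [set: L]) (hL : hausdorff_space L).

Definition chained_ent : set_system (K * K) :=
  [set E | exists2 F, diagonal_nbhs F & chained F `<=` E].

Lemma chained_ent_filter : Filter chained_ent.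
Proof.
apply: filter_from_filter; first by exists setT; exact: diagonal_nbhsT.
move=> F G dF dG; exists (F `&` G); first exact: diagonal_nbhsI.
by move=> xy FG; split; move: FG; apply: chained_sub => ? [].
Qed.

Lemma chained_ent_split E : chained_ent E -> exists2 D, chained_ent D &
  forall x y z, D (x, y) -> D (y, z) -> E (x, z).
Proof.
move=> [F dF FE]; have [G dG GF] := diagonal_nbhs_split cL hL dF.
exists (chained G); first by exists G.
by move=> x y z xy yz; apply: FE; exact: chained_trans dG GF xy yz.
Qed.

Lemma chained_ent_refl E x : chained_ent E -> E (x, x).
Proof. by move=> [F dF]; apply; exact: chained_refl. Qed.

Lemma chained_ent_inv E :
  chained_ent E -> chained_ent [set xy | E (xy.2, xy.1)].
Proof.
by move=> [F dF FE]; exists F => // -[x y] /chained_sym/FE.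
Qed.

Definition chained_uniformity : uniformity K :=
  Uniformity chained_ent_filter chained_ent_refl chained_ent_inv
    chained_ent_split.

End Chaining.

(** * The quotient system *)

Section ChainQuotient.
Variables (S : topSemigroupType) (K L : tds S) (p : K -> L).
Hypotheses (lcK : locally_connected K) (eqL : equicontinuous_tds L).
Hypotheses (cp : continuous p) (ep : forall s x, p (act s x) = act s (p x)).

Let U := chained_uniformity p (@tds_compact _ L) (@tds_hausdorff _ L).
Let M := hquot U.
Let q : K -> M := to_hquot U.

Lemma act_tds_continuous (s : S) : continuous (act s : K -> K).
Proof.
move=> x; apply: (@continuous_comp _ _ _ (pair s) (fun sx => act sx.1 sx.2)).
  by apply: cvg_pair => //=; exact: cvg_cst.
exact: act_continuous.
Qed.

Lemma orbit_tds_continuous (x : K) : continuous (fun s : S => act s x).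
Proof.
move=> s; apply: (@continuous_comp _ _ _ (pair^~ x) (fun sx => act sx.1 sx.2)).
  by apply: cvg_pair => //=; exact: cvg_cst.
exact: act_continuous.
Qed.

(** Equicontinuity of [L] lifts to the chain uniformity, because acting by [s]
    keeps a connected set connected and commutes with taking its image. *)
Lemma act_chained E : unif U E -> exists2 D, unif U D &
  forall (s : S) x y, D (x, y) -> E (act s x, act s y).
Proof.
move=> [F dF FE]; have [G dG GF] := eqL dF.
exists (chained p G); first by exists G.
move=> s x y [C [cC Cx Cy CG]]; apply: FE; exists (act s @` C); split.
- apply: connected_continuous_connected => //.
  exact/continuous_subspaceT/act_tds_continuous.
- by exists x.
- by exists y.
- by move=> _ _ [u Cu <-] [v Cv <-]; rewrite !ep; apply: GF; exact: CG.
Qed.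

Let q_continuous : continuous q.
Proof.
move=> x A /nbhsP[E [F dF FE] EA].
have [[V W] /= [xV xW] VW] := chained_diagonal_nbhs lcK cp dF x.
apply: filterS xW => y Wy; apply/EA/xsectionP.
by apply: (FE (x, y)); apply: VW; split => //; exact: nbhs_singleton xV.
Qed.

Let actM (s : S) (m : M) : M := q (act s (repr m)).

Let q_equivariant s x : q (act s x) = actM s (q x).
Proof.
apply/to_hquotP => E /act_chained[D UD]; apply.
by move: D UD; apply/to_hquotP; rewrite to_hquot_repr.
Qed.

Let q_surjective m : exists x, q x = m.
Proof. by exists (repr m); exact: to_hquot_repr. Qed.

Let actM_mul s t m : actM (s * t)%g m = actM s (actM t m).
Proof. by have [x <-] := q_surjective m; rewrite -!q_equivariant act_mul. Qed.

Let actM_equicontinuous (E : set (M * M)) : entourage E ->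
  exists2 D, entourage D & forall s m n, D (m, n) -> E (actM s m, actM s n).
Proof.
move=> /act_chained[D UD DE]; have [D' UD' D'D] := hquot_image_sub UD.
exists (hquot_image D'); first exact: hquot_ent_image.
move=> s m n; have [x <-] := q_surjective m; have [y <-] := q_surjective n.
by move=> /D'D/DE; rewrite -!q_equivariant; apply.
Qed.

(** Equicontinuity upgrades separate to joint continuity: [s m] and [t n] are
    compared through [t m], and the estimate from [t m] to [t n] is uniform in
    [t]. *)
Let actM_continuous : continuous (fun sm : S * M => actM sm.1 sm.2).
Proof.
move=> [s m] A /= /nbhsP[E entE EA].
have [D entD DE] := actM_equicontinuous (entourage_split_ent entE).
have [x qx] := q_surjective m.
have : nbhs s [set t | split_ent E (actM s m, actM t m)].
  have sc : continuous (fun t : S => actM t m).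
    have -> : (fun t : S => actM t m) = q \o (fun t => act t x).
      by apply/funext => t; rewrite /= q_equivariant qx.
    move=> t; apply: (@continuous_comp _ _ _ (fun t => act t x) q).
      exact: orbit_tds_continuous.
    exact: q_continuous.
  have := sc s _ (nbhs_entourage _ (entourage_split_ent entE)).
  by apply: (@filterS S (nbhs s)) => t /xsectionP.
move=> sB; exists ([set t | split_ent E (actM s m, actM t m)], xsection D m).
  by split => //; exact: nbhs_entourage.
move=> [t n] [/= st /xsectionP mn]; apply/EA/xsectionP.
exact: (entourage_split (actM t m)) (DE _ _ _ mn).
Qed.

Let M_compact : compact [set: M].
Proof.
have <- : q @` [set: K] = setT.
  by apply/seteqP; split => // m _; have [x <-] := q_surjective m; exists x.
apply: continuous_compact; last exact: tds_compact.
exact: continuous_subspaceT.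
Qed.

Lemma chain_quotient : exists (N : tds S) (r : K -> N),
  [/\ equicontinuous_tds N, factor_map r &
      forall x y, r x = r y -> forall F, diagonal_nbhs F -> chained p F (x, y)].
Proof.
exists (Tds M_compact (@hquot_hausdorff _ U) actM_mul actM_continuous), q.
split; last first.
- by move=> x y /to_hquotP xy F dF; apply: xy; exists F.
- split => //; first by move=> m _; have [x <-] := q_surjective m; exists x.
- move=> E /= /(compact_entourageE _ M_compact)/actM_equicontinuous[D entD DE].
  by exists D => //; exact/(compact_entourageE _ M_compact).
Qed.

End ChainQuotient.

Theorem theorem2p7 (S : topSemigroupType) (K : tds S)
    (hK : locally_connected K)
    (hmono : forall s : S, monotone_map (fun x : K => act s x))
    (L : tds S) (p : K -> L) (hp : maximal_equicontinuous_factor p) :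
  monotone_map p.
Proof.
have [eqL [cp _ ep] maxp] := hp.
have [M [q [eqM fq qP]]] := chain_quotient hK eqL cp ep.
have [r _ qr] := maxp M q eqM fq.
move=> y0; apply: chained_fiber_connected => //.
- exact: tds_compact.
- exact: tds_hausdorff.
- exact: tds_hausdorff.
- move=> x y px py; apply: qP.
  by rewrite qr /= px py.
Qed.
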